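(* Let $\nu,\mu$ be computable probability measures on Cantor space $2^{\mathbb{N}}$ with full support such that $\nu\ll\mu$ and the Radon-Nikodym derivative $\frac{d\nu}{d\mu}$ is $L_2(\mu)$-computable. Then both $\nu\ll_{bdc}\mu$ and $\nu\ll_{comp}\mu$.
   Context: A probability measure $\nu$ on Cantor space is identified with the function $\sigma\mapsto\nu(\sigma):=\nu([\sigma])$ on $2^{<\mathbb{N}}$, where $[\sigma]$ is the set of $\omega\in 2^{\mathbb{N}}$ extending $\sigma$. It is computable if the reals $\nu(\sigma)$ are computable uniformly in $\sigma$; it has full support if $\nu(\sigma)>0$ for all $\sigma$. $\omega\upharpoonright n$ is the length-$n$ initial segment of $\omega$. A function $h$ is $L_2(\mu)$-computable if it is a computable point of the computable Polish space $L_2(\mu)$, i.e. $h\in L_2(\mu)$ and there is a computable sequence $f_n$ of finite rational linear combinations of indicator functions of basic clopen sets $[\sigma]$ with $\|f_n-h\|_{L_2(\mu)}\le 2^{-n}$ for all $n$. $\nu\ll_{bdc}\mu$ iff $\mathbb{E}_{\nu}\sup_n\frac{\nu(\cdot\upharpoonright n)}{\mu(\cdot\upharpoonright n)}$ (expectation of $\omega\mapsto\sup_n \frac{\nu(\omega\upharpoonright n)}{\mu(\omega\upharpoonright n)}$) is finite and is a computable real. $\nu\ll_{comp}\mu$ iff there is a computable function $m:\mathbb{Q}^{>0}\to\mathbb{Q}^{>0}$ such that for all rationals $\epsilon>0$ and all Borel $A\subseteq 2^{\mathbb{N}}$, if $\mu(A)<m(\epsilon)$ then $\nu(A)<\epsilon$.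 *)

(* Defs.v *)
From HB Require Import structures.
From mathcomp Require Import all_boot all_order all_algebra.
From mathcomp Require Import all_classical all_reals all_analysis.

Set Implicit Arguments.
Unset Strict Implicit.
Unset Printing Implicit Defensive.

Import Order.TTheory GRing.Theory Num.Theory.
Local Open Scope classical_set_scope.
Local Open Scope ring_scope.

(* Total recursive functions: the least class containing zero, successor and
   projections, closed under composition, primitive recursion, and
   minimization of regular functions (those that have a zero for every value
   of the parameters).  The last two closure conditions are stated through the
   defining equations of the resulting function. *)
Inductive recursive : forall k : nat, (k.-tuple nat -> nat) -> Prop :=
| recursive_zero k :
    recursive (fun _ : k.-tuple nat => 0%N)
| recursive_succ :
    recursive (fun t : 1.-tuple nat => (thead t).+1)
| recursive_proj k (i : 'I_k) :
    recursive (fun t : k.-tuple nat => tnth t i)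
| recursive_comp k m (f : m.-tuple nat -> nat)
    (g : 'I_m -> k.-tuple nat -> nat) :
    recursive f -> (forall i, recursive (g i)) ->
    recursive (fun t : k.-tuple nat => f [tuple g i t | i < m])
| recursive_prec k (g : k.-tuple nat -> nat) (h : k.+2.-tuple nat -> nat)
    (f : k.+1.-tuple nat -> nat) :
    recursive g -> recursive h ->
    (forall t : k.-tuple nat, f [tuple of 0%N :: t] = g t) ->
    (forall n (t : k.-tuple nat),
       f [tuple of n.+1 :: t] = h [tuple of n :: f [tuple of n :: t] :: t]) ->
    recursive f
| recursive_min k (f : k.+1.-tuple nat -> nat) (g : k.-tuple nat -> nat) :
    recursive f ->
    (forall t : k.-tuple nat, f [tuple of g t :: t] = 0%N) ->
    (forall (t : k.-tuple nat) n,
       (n < g t)%N -> f [tuple of n :: t] <> 0%N) ->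
    recursive g.

Definition uncurry1 T (f : nat -> T) (t : 1.-tuple nat) : T :=
  f (nth 0%N t 0).
Definition uncurry2 T (f : nat -> nat -> T) (t : 2.-tuple nat) : T :=
  f (nth 0%N t 0) (nth 0%N t 1).
Definition uncurry3 T (f : nat -> nat -> nat -> T) (t : 3.-tuple nat) : T :=
  f (nth 0%N t 0) (nth 0%N t 1) (nth 0%N t 2).

Definition computable_rat k (q : k.-tuple nat -> rat) : Prop :=
  exists a b c : k.-tuple nat -> nat,
    [/\ recursive a, recursive b, recursive c &
        forall t, q t = ((a t)%:R - (b t)%:R) / (c t).+1%:R].

(* The string of length [l] formed by the [l] low-order binary digits of [v],
   lowest first; every finite string arises in this way. *)
Definition bits (l v : nat) : seq bool := mkseq (fun i => odd (v %/ 2 ^ i)) l.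

Definition computable_string k (s : k.-tuple nat -> seq bool) : Prop :=
  exists l v : k.-tuple nat -> nat,
    [/\ recursive l, recursive v & forall t, s t = bits (l t) (v t)].

Definition computable_real (R : realType) (x : R) : Prop :=
  exists q : nat -> rat,
    computable_rat (uncurry1 q) /\
    forall n, `|ratr (q n) - x| <= 2 ^- n.

(* [x s] is a computable real, uniformly in the string [s]. *)
Definition computable_real_of_string (R : realType) (x : seq bool -> R) : Prop :=
  exists q : seq bool -> nat -> rat,
    computable_rat (uncurry3 (fun l v n => q (bits l v) n)) /\
    forall s n, `|ratr (q s n) - x s| <= 2 ^- n.

(* Every positive rational is some [i.+1%:R / j.+1%:R]; the values of [m]
   outside the positive rationals are irrelevant. *)
Definition computable_pos_rat_fun (m : rat -> rat) : Prop :=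
  (forall e, 0 < e -> 0 < m e) /\
  computable_rat (uncurry2 (fun i j => m (i.+1%:R / j.+1%:R))).

Notation borel_cantor := (g_sigma_algebraType (@open cantor_space)).

Definition prefix_of (w : borel_cantor) (n : nat) : seq bool := mkseq w n.

Definition cylinder (s : seq bool) : set borel_cantor :=
  [set w | prefix_of w (size s) = s].

Section measures_on_cantor_space.
Context {R : realType}.
Implicit Types nu mu : probability borel_cantor R.

Definition str_measure nu (s : seq bool) : R := fine (nu (cylinder s)).

Definition computable_measure nu : Prop :=
  computable_real_of_string (str_measure nu).

Definition full_support nu : Prop := forall s, 0 < str_measure nu s.

Definition RN_derivative nu mu (w : borel_cantor) : R :=
  fine (Radon_Nikodym (charge_of_finite_measure nu) mu w).

Definition L2_computable mu (h : borel_cantor -> R) : Prop :=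
  h \in Lfun mu 2%:E /\
  exists (len : nat -> nat) (q : nat -> nat -> rat)
         (s : nat -> nat -> seq bool),
    [/\ recursive (uncurry1 len), computable_rat (uncurry2 q),
        computable_string (uncurry2 s) &
        forall n,
          ('N[mu]_2%:E[(fun w =>
             (\sum_(i < len n) ratr (q n i) * \1_(cylinder (s n i)) w
              - h w)%:E)]
           <= (2 ^- n)%:E)%E].

Definition bdc_dominated nu mu : Prop :=
  exists r : R,
    (\int[nu]_w ereal_sup (range (fun n =>
        (str_measure nu (prefix_of w n) / str_measure mu (prefix_of w n))%:E))
     = r%:E)%E /\
    computable_real r.

Definition comp_dominated nu mu : Prop :=
  exists m : rat -> rat,
    computable_pos_rat_fun m /\
    forall e : rat, 0 < e ->
    forall A : set borel_cantor, measurable A ->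
      (mu A < (ratr (m e))%:E -> nu A < (ratr e)%:E)%E.

End measures_on_cantor_space.

(* Main.v *)
(* With h = dnu/dmu, the inequality h <= (l h^2 + 1/l) / 2 integrated over A
   bounds nu(A) by (l ||h||^2 + mu(A)/l) / 2, so that m(e) = e^2 / c is a
   modulus for any positive integer c >= ||h||^2.

   Let M_k be the mu-martingale nu(w|k) / mu(w|k).  By Doob's L^2 maximal
   inequality and Cauchy-Schwarz, stopping the running maximum at depth N costs
   at most 2 ||h|| ||h - M_N|| in nu-mean.  If all strings occurring in the n-th
   approximation f_n of h have length at most N, then M_N is at least as close to
   h as f_n, so E_nu sup_k M_k is a computable limit of the finite means
   E_nu max_(k <= N) M_k, each of which is obtained from the masses of cylinders
   by sums, products, quotients and maxima. *)

Require Import Defs.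
From mathcomp Require Import all_boot all_order all_algebra.
From mathcomp Require Import all_classical all_reals all_analysis.
From mathcomp Require Import measurable_realfun.
From mathcomp Require Import ring lra.

Set Implicit Arguments.
Unset Strict Implicit.
Unset Printing Implicit Defensive.

Import Order.TTheory GRing.Theory Num.Theory.
Local Open Scope classical_set_scope.
Local Open Scope ring_scope.

(** * Recursive functions *)

Lemma recursive_ext k (f g : k.-tuple nat -> nat) :
  f =1 g -> recursive g -> recursive f.
Proof. by move=> /funext ->. Qed.

Lemma recursive_nth k i : (i < k)%N ->
  recursive (fun t : k.-tuple nat => nth 0%N t i).
Proof.
move=> ik; apply: recursive_ext (recursive_proj (Ordinal ik)) => t.
by rewrite (tnth_nth 0%N).
Qed.

Lemma recursive_S k (a : k.-tuple nat -> nat) :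
  recursive a -> recursive (fun t => (a t).+1).
Proof.
move=> ra.
apply: recursive_ext (recursive_comp recursive_succ (g := fun _ => a) _) => //.
by move=> t; rewrite /thead tnth_mktuple.
Qed.

Lemma recursive_const k c : recursive (fun _ : k.-tuple nat => c).
Proof. by elim: c => [|c IH]; [exact: recursive_zero|exact: recursive_S]. Qed.

Lemma recursive_comp_seq k m (F : m.-tuple nat -> nat)
    (gs : m.-tuple (k.-tuple nat -> nat)) :
  recursive F -> (forall i, recursive (tnth gs i)) ->
  recursive (fun t => F [tuple of [seq g t | g <- gs]]).
Proof.
move=> rF rg; apply: recursive_ext (recursive_comp rF rg) => t.
by congr F; apply: eq_from_tnth => i; rewrite tnth_map tnth_mktuple.
Qed.

Lemma recursive_comp1 k (F : 1.-tuple nat -> nat) (a : k.-tuple nat -> nat) :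
  recursive F -> recursive a -> recursive (fun t => F [tuple a t]).
Proof.
move=> rF ra.
apply: recursive_ext (recursive_comp_seq (gs := [tuple a]) rF _).
  by move=> t; congr F; apply: val_inj.
by case; case=> // i.
Qed.

Lemma recursive_comp2 k (F : 2.-tuple nat -> nat) (a b : k.-tuple nat -> nat) :
  recursive F -> recursive a -> recursive b ->
  recursive (fun t => F [tuple a t; b t]).
Proof.
move=> rF ra rb.
apply: recursive_ext (recursive_comp_seq (gs := [tuple a; b]) rF _).
  by move=> t; congr F; apply: val_inj.
by case; case=> // -[].
Qed.

Lemma recursive_comp3 k (F : 3.-tuple nat -> nat)
    (a b c : k.-tuple nat -> nat) :
  recursive F -> recursive a -> recursive b -> recursive c ->
  recursive (fun t => F [tuple a t; b t; c t]).
Proof.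
move=> rF ra rb rc.
apply: recursive_ext (recursive_comp_seq (gs := [tuple a; b; c]) rF _).
  by move=> t; congr F; apply: val_inj.
by case; do 3?[case=> //].
Qed.

Lemma recursive_app1 k (F : nat -> nat) (a : k.-tuple nat -> nat) :
  recursive (uncurry1 F) -> recursive a -> recursive (fun t => F (a t)).
Proof. exact: recursive_comp1. Qed.

Lemma recursive_app2 k (F : nat -> nat -> nat) (a b : k.-tuple nat -> nat) :
  recursive (uncurry2 F) -> recursive a -> recursive b ->
  recursive (fun t => F (a t) (b t)).
Proof. exact: recursive_comp2. Qed.

Lemma recursive_app3 k (F : nat -> nat -> nat -> nat)
    (a b c : k.-tuple nat -> nat) :
  recursive (uncurry3 F) -> recursive a -> recursive b -> recursive c ->
  recursive (fun t => F (a t) (b t) (c t)).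
Proof. exact: recursive_comp3. Qed.

(** The argument order follows [recursive_prec], so that its defining equations hold by computation.
    Callers with fewer than two parameters fill up with 0. *)
Fixpoint natrec (h : nat -> nat -> nat -> nat -> nat) (z : nat -> nat -> nat)
    (n x y : nat) : nat :=
  if n is m.+1 then h m (natrec h z m x y) x y else z x y.

Definition uncurry4 (F : nat -> nat -> nat -> nat -> nat) (t : 4.-tuple nat) :=
  F (nth 0%N t 0) (nth 0%N t 1) (nth 0%N t 2) (nth 0%N t 3).

Lemma recursive_natrec h z : recursive (uncurry4 h) -> recursive (uncurry2 z) ->
  recursive (uncurry3 (natrec h z)).
Proof. by move=> rh rz; apply: recursive_prec rz rh _ _ => // t. Qed.

Lemma recursive_nat_iter k h z (a x y : k.-tuple nat -> nat) :
  recursive (uncurry4 h) -> recursive (uncurry2 z) ->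
  recursive a -> recursive x -> recursive y ->
  recursive (fun t => natrec h z (a t) (x t) (y t)).
Proof.
by move=> rh rz ra rx ry; apply: recursive_app3 => //; apply: recursive_natrec.
Qed.

Lemma recursive_add k (a b : k.-tuple nat -> nat) :
  recursive a -> recursive b -> recursive (fun t => a t + b t)%N.
Proof.
move=> ra rb.
apply: (recursive_ext (g := fun t => natrec (fun _ r _ _ => r.+1)
  (fun x _ => x) (b t) (a t) 0)).
  by move=> t; elim: (b t) => [|n /= <-]; rewrite ?addn0 ?addnS.
apply: recursive_nat_iter => //; last exact: recursive_zero.
- by apply: recursive_S; apply: recursive_nth.
- exact: recursive_nth.
Qed.

Lemma recursive_pred k (a : k.-tuple nat -> nat) :
  recursive a -> recursive (fun t => (a t).-1)%N.
Proof.
move=> ra.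
apply: (recursive_ext (g := fun t => natrec (fun m _ _ _ => m)
  (fun _ _ => 0%N) (a t) 0 0)).
  by move=> t; case: (a t).
apply: recursive_nat_iter => //; try exact: recursive_zero.
exact: recursive_nth.
Qed.

Lemma recursive_sub k (a b : k.-tuple nat -> nat) :
  recursive a -> recursive b -> recursive (fun t => a t - b t)%N.
Proof.
move=> ra rb.
apply: (recursive_ext (g := fun t => natrec (fun _ r _ _ => r.-1)
  (fun x _ => x) (b t) (a t) 0)).
  by move=> t; elim: (b t) => [|n /= <-]; rewrite ?subn0 ?subnS.
apply: recursive_nat_iter => //; last exact: recursive_zero.
- by apply: recursive_pred; apply: recursive_nth.
- exact: recursive_nth.
Qed.

Lemma recursive_mul k (a b : k.-tuple nat -> nat) :
  recursive a -> recursive b -> recursive (fun t => a t * b t)%N.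
Proof.
move=> ra rb.
apply: (recursive_ext (g := fun t => natrec (fun _ r x _ => x + r)%N
  (fun _ _ => 0%N) (b t) (a t) 0)).
  by move=> t; elim: (b t) => [|n /= <-]; rewrite ?muln0 ?mulnS.
apply: recursive_nat_iter => //; try exact: recursive_zero.
by apply: recursive_add; apply: recursive_nth.
Qed.

Lemma recursive_max k (a b : k.-tuple nat -> nat) :
  recursive a -> recursive b -> recursive (fun t => maxn (a t) (b t)).
Proof.
move=> ra rb; apply: (recursive_ext (g := fun t => a t + (b t - a t))%N).
  by move=> t; rewrite maxnE.
by apply: recursive_add => //; exact: recursive_sub.
Qed.

Lemma recursive_exp2 k (a : k.-tuple nat -> nat) :
  recursive a -> recursive (fun t => 2 ^ a t)%N.
Proof.
move=> ra; apply: (recursive_ext (g := fun t => natrec (fun _ r _ _ => 2 * r)%N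
  (fun _ _ => 1%N) (a t) 0 0)).
  by move=> t; elim: (a t) => [|n /= <-]; rewrite ?expn0 ?expnS.
apply: recursive_nat_iter => //; try exact: recursive_const.
by apply: recursive_mul; [exact: recursive_const|exact: recursive_nth].
Qed.

Lemma recursive_divS k (a b : k.-tuple nat -> nat) :
  recursive a -> recursive b -> recursive (fun t => a t %/ (b t).+1)%N.
Proof.
move=> ra rb.
apply: (@recursive_app2 k (fun x y => x %/ y.+1)%N) => //.
(* The quotient is the least [n] with [x < n.+1 * y.+1]; the truncated difference is zero exactly
   for such [n]. *)
apply: (@recursive_min 2 (fun t : 3.-tuple nat =>
   ((nth 0 t 1).+1 - (nth 0 t 0).+1 * (nth 0 t 2).+1))%N).
- apply: recursive_sub; first by apply: recursive_S; apply: recursive_nth.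
  by apply: recursive_mul; apply: recursive_S; apply: recursive_nth.
- move=> t; rewrite /uncurry2 /=; set x := nth _ _ 0; set y := nth _ _ 1.
  by apply/eqP; rewrite subn_eq0 ltn_ceil.
- move=> t n; rewrite /uncurry2 /=; set x := nth _ _ 0; set y := nth _ _ 1.
  by rewrite leq_divRL // => h; apply/eqP; rewrite subn_eq0 -ltnNge ltnS.
Qed.

Lemma recursive_sum k (F : nat -> nat -> nat -> nat)
    (a x y : k.-tuple nat -> nat) :
  recursive (uncurry3 F) -> recursive a -> recursive x -> recursive y ->
  recursive (fun t => \sum_(0 <= i < a t) F i (x t) (y t))%N.
Proof.
move=> rF ra rx ry.
apply: (recursive_ext (g := fun t => natrec (fun i r x y => r + F i x y)%N
  (fun _ _ => 0%N) (a t) (x t) (y t))).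
  move=> t; elim: (a t) => [|n IH] /=; first by rewrite big_geq.
  by rewrite big_nat_recr //= IH.
apply: recursive_nat_iter => //; try exact: recursive_zero.
apply: recursive_add; first exact: recursive_nth.
by apply: recursive_app3 => //; apply: recursive_nth.
Qed.

Lemma recursive_runmax k (F : nat -> nat -> nat -> nat)
    (a x y : k.-tuple nat -> nat) :
  recursive (uncurry3 F) -> recursive a -> recursive x -> recursive y ->
  recursive (fun t => \max_(0 <= i < (a t).+1) F i (x t) (y t))%N.
Proof.
move=> rF ra rx ry.
apply: (recursive_ext (g := fun t => natrec (fun i r x y => maxn r (F i.+1 x y))%N
  (F 0%N) (a t) (x t) (y t))).
  move=> t; elim: (a t) => [|n IH] /=; first by rewrite big_nat1.
  by rewrite big_nat_recr //= IH.
apply: recursive_nat_iter => //.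
- apply: recursive_max; first exact: recursive_nth.
  by apply: recursive_app3 => //; do ?apply: recursive_S; apply: recursive_nth.
- by apply: recursive_app3 => //; try exact: recursive_zero; apply: recursive_nth.
Qed.

(** * Approximable families of reals *)

(* Any recursive error bound [e] will do: the error of [f (m * n) / m] is
   [e / m], so [m] can be chosen recursively to make it as small as needed. *)
Definition approximable (R : realType) (x : nat -> nat -> R) : Prop :=
  exists (f : nat -> nat -> nat -> nat) (e : nat -> nat -> nat),
    [/\ recursive (uncurry3 f), recursive (uncurry2 e) &
        forall n i j, `|(f n i j)%:R - n%:R * x i j| <= (e i j)%:R].

Ltac rec :=
  rewrite /uncurry1 /uncurry2 /uncurry3 /uncurry4 /=;
  repeat first
  [ exact: recursive_const
  | apply: recursive_nth; by []
  | apply: recursive_S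
  | apply: recursive_add
  | apply: recursive_sub
  | apply: recursive_mul
  | apply: recursive_divS
  | apply: recursive_exp2
  | apply: recursive_pred
  | apply: recursive_app1; [by []|..]
  | apply: recursive_app2; [by []|..]
  | apply: recursive_app3; [by []|..] ].

Lemma divn_error (R : realType) (a d : nat) :
  (a %/ d.+1)%:R * d.+1%:R <= a%:R :> R /\
  a%:R <= ((a %/ d.+1)%:R + 1) * d.+1%:R :> R.
Proof.
by rewrite natr1 -!natrM !ler_nat leq_divM ltnW // ltn_ceil.
Qed.

(** The product of the approximations is close to [n ^ 2 * x * y], so it is divided by [n], or by 1
    when [n = 0]. The approximations at [n = 1] give recursive upper bounds [f 1 + e] and
    [f' 1 + e'] for [x] and [y], which control the cross terms; the final 1 pays for rounding. *)
Lemma approximable_mul (R : realType) (x y : nat -> nat -> R) :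
  (forall i j, 0 <= x i j) -> (forall i j, 0 <= y i j) ->
  approximable x -> approximable y ->
  approximable (fun i j => x i j * y i j).
Proof.
move=> x0 y0 [f [e [rf re fe]]] [f' [e' [rf' re' fe']]].
exists (fun n i j => (f n i j * f' n i j) %/ (n.-1).+1)%N.
exists (fun i j => (f 1 i j + e i j) * e' i j + (f' 1 i j + e' i j) * e i j +
    e i j * e' i j + 1)%N.
split; [by rec|by rec|] => n i j.
have := x0 i j; have := y0 i j.
have := fe 1%N i j; have := fe' 1%N i j.
have := fe n i j; have := fe' n i j.
set a := f n i j; set b := f' n i j; set u := x i j; set v := y i j.
rewrite !ler_norml !(natrD, natrM).
move: (e i j) (e' i j) (f 1%N i j) (f' 1%N i j) => c d a1 b1.
(* For [n = 0] both factors are at most their errors, so the product is at most [e * e']. *)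
have [->|n0] := posnP n.
  rewrite divn1 !mul0r natrM.
  have := ler0n R a; have := ler0n R b; have := ler0n R c; have := ler0n R d.
  have := ler0n R a1; have := ler0n R b1.
  move: (a%:R : R) (b%:R : R) (c%:R : R) (d%:R : R) (a1%:R : R) (b1%:R : R).
  move=> {}a {}b {}c {}d {}a1 {}b1 a1_0 b1_0 d0 c0 b0 a0.
  move=> /andP[_ B2] /andP[_ A2] /andP[_ C2] /andP[_ D2] v0 u0.
  rewrite !subr0 in A2 B2; rewrite mul1r in C2 D2; rewrite subr0.
  have ab : a * b <= c * d by apply: ler_pM.
  have p1 := mulr_ge0 b1_0 d0; have p2 := mulr_ge0 a1_0 c0.
  have p3 := mulr_ge0 c0 d0; have p4 := mulr_ge0 a0 b0.
  by apply/andP; split; lra.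
have := divn_error R (a * b) n.-1; rewrite prednK //.
set q := (_ %/ _)%N; rewrite natrM.
have : 1 <= n%:R :> R by rewrite ler1n.
have := ler0n R a; have := ler0n R b; have := ler0n R c; have := ler0n R d.
have := ler0n R a1; have := ler0n R b1.
move: (q%:R : R) (n%:R : R) (a%:R : R) (b%:R : R) (c%:R : R) (d%:R : R)
   (a1%:R : R) (b1%:R : R).
move=> {}q {n0}n {}a {}b {}c {}d {}a1 {}b1 h1 h2 h3 h4 h5 h6 n1 [q1 q2].
move=> /andP[B1 B2] /andP[A1 A2] /andP[C1 C2] /andP[D1 D2] v0 u0.
have u1 : u <= a1 + c by lra.
have v1 : v <= b1 + d by lra.
pose al := a - n * u; pose be := b - n * v.
have Eab : a * b = n * (n * (u * v)) + n * (u * be + v * al) + al * be.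
  by rewrite /al /be; ring.
have H1 : `|u * be| <= (a1 + c) * d.
  by rewrite normrM; apply: ler_pM => //; [rewrite ger0_norm|rewrite ler_norml B1].
have H2 : `|v * al| <= (b1 + d) * c.
  by rewrite normrM; apply: ler_pM => //; [rewrite ger0_norm|rewrite ler_norml A1].
have H3 : `|al * be| <= c * d.
  by rewrite normrM; apply: ler_pM => //; rewrite ler_norml ?A1 ?B1.
move: H1 H2 H3; rewrite !ler_norml => /andP[H1 H1'] /andP[H2 H2'] /andP[H3 H3'].
have cdn : c * d <= n * (c * d) by rewrite ler_peMl // mulr_ge0.
have npos : 0 < n by lra.
rewrite -(ler_pM2l npos) in H1; rewrite -(ler_pM2l npos) in H1'.
rewrite -(ler_pM2l npos) in H2; rewrite -(ler_pM2l npos) in H2'.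
by apply/andP; split; rewrite -(ler_pM2l npos); lra.
Qed.

(** Here [a] approximates [n * v], [p] bounds [v^-1], and [q] is [n * n / a] rounded down. The lower
    bound on [n] forces [n * v <= 2 * a]; then [n * n - a * (n / v) = - (a - n * v) * (n / v)] is at
    most [a * (2 * e * p * p)] in absolute value. The first two terms of the bound are those that
    [approximable_inv] has for small [n]. *)
Lemma inv_error (R : realType) (n a e p v q : R) :
  2 * e * p + 2 <= n -> - e <= a - n * v -> a - n * v <= e -> 0 < a ->
  0 < v -> 1 <= p * v -> 0 <= e -> 0 <= p -> 0 <= n ->
  q * a <= n * n -> n * n <= (q + 1) * a ->
  `|q - n * v^-1| <= (2 * e * p + 2) * (2 * e * p + 2) + (2 * e * p + 2) * p +
     2 * e * p * p + 1.
Proof.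
move=> Bn h1 h2 a0 v0 pv e0 p0 n0 q1 q2.
have pv' : v^-1 <= p by rewrite -[_^-1]mul1r ler_pdivrMr.
have vi0 : 0 <= v^-1 by rewrite invr_ge0 ltW.
rewrite ler_norml; set w := v^-1 in vi0 pv' *.
have vw : v * w = 1 by rewrite mulfV // gt_eqF.
have epv : e <= e * (p * v) by rewrite ler_peMr.
have nv : 2 * e <= n * v.
  by have : (2 * e * p + 2) * v <= n * v; [rewrite ler_pM2r|lra].
have anv : n * v <= 2 * a by lra.
have nw : n <= 2 * (a * w).
  by have := ler_wpM2r vi0 anv; rewrite -mulrA vw; lra.
have nwp : n <= 2 * (a * p).
  by have : a * w <= a * p; [rewrite ler_pM2l|lra].
have K : `|n * n - a * (n * w)| <= a * (2 * e * p * p).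
  have -> : n * n - a * (n * w) = - ((a - n * v) * (n * w)).
    by rewrite -{1}[n * n]mulr1 -vw; ring.
  rewrite normrN normrM.
  have -> : a * (2 * e * p * p) = e * (2 * (a * p) * p) by ring.
  apply: ler_pM; rewrite ?normr_ge0 //; first by rewrite ler_norml h1.
  rewrite ger0_norm ?mulr_ge0 //.
  by apply: ler_pM.
move: K; rewrite ler_norml => /andP[K1 K2].
set Z := 2 * e * p.
have Z0 : 0 <= Z by rewrite /Z !mulr_ge0.
have X0 : 0 <= a * ((Z + 2) * (Z + 2)) by rewrite !mulr_ge0 // ?addr_ge0 // ltW.
have Y0 : 0 <= a * ((Z + 2) * p) by rewrite !mulr_ge0 // ?addr_ge0 // ltW.
rewrite -/Z in K1 K2.
by apply/andP; split; rewrite -(ler_pM2l a0); lra.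
Qed.

(** Positivity alone gives no explicit lower bound on [y], so a natural number [p >= 1 / y] is found
    by unbounded search: at the first [n] where the approximation exceeds its error bound [e], one
    has [n * y >= 1]. *)
Lemma approximable_inv (R : realType) (y : nat -> nat -> R) :
  (forall i j, 0 < y i j) -> approximable y ->
  approximable (fun i j => (y i j)^-1).
Proof.
move=> y0 [b [e [rb re be]]].
(* The search ends: once [n * y] exceeds [2 * e + 1], the approximation is above [e + 1]. *)
have ex i j : exists n, ((e i j).+1 - b n i j)%N == 0%N.
  have [n Hn] : exists n : nat, ((2 * e i j).+1%:R : R) / y i j < n%:R.
    by eexists; apply: archi_boundP; rewrite divr_ge0 // ltW.
  exists n; rewrite subn_eq0 -(ler_nat R).
  move: Hn (be n i j); rewrite ltr_pdivrMr // ler_norml -!natr1 natrM.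
  by move=> h /andP[h1 h2]; lra.
pose p i j := ex_minn (ex i j).
have rp : recursive (uncurry2 p).
  apply: (@recursive_min 2 (fun t : 3.-tuple nat =>
     ((e (nth 0 t 1) (nth 0 t 2)).+1
       - b (nth 0 t 0) (nth 0 t 1) (nth 0 t 2))%N)).
  - by rec.
  - move=> t; rewrite /uncurry2 /= /p.
    by case: ex_minnP => m /eqP.
  - move=> t n; rewrite /uncurry2 /= /p.
    case: ex_minnP => m _ mmin nm /eqP /mmin.
    by rewrite leqNgt nm.
have yp i j : 1 <= (p i j)%:R * y i j.
  rewrite /p; case: ex_minnP => m; rewrite subn_eq0 -(ler_nat R) => h _.
  by have := be m i j; rewrite ler_norml -natr1 in h * => /andP[]; lra.
exists (fun n i j => (n * n) %/ ((b n i j).-1).+1)%N.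
pose B i j := (2 * e i j * p i j + 2)%N.
exists (fun i j => B i j * B i j + B i j * p i j + 2 * e i j * p i j * p i j + 1)%N.
split; [by rec|by rewrite /B; rec|] => n i j.
rewrite ler_norml; move: (yp i j) (be n i j) (y0 i j).
rewrite /B; set a := b n i j; set v := y i j.
set pp := p i j; set ee := e i j.
move=> pv.
rewrite ler_norml => /andP[h1 h2] v0.
have pv' : v^-1 <= pp%:R by rewrite -[_^-1]mul1r ler_pdivrMr.
have vi0 : 0 <= v^-1 by rewrite invr_ge0 ltW.
(* Below this threshold the approximation may vanish. The quotient is then at most [n * n] and
   [n / y] at most [n * p], which the first two terms of the bound cover. *)
have [nB|Bn] := ltnP n (2 * ee * pp + 2).
  have : ((n * n) %/ a.-1.+1 <= n * n)%N by exact: leq_div.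
  rewrite -(ler_nat R) => qn.
  have nn : (n * n <= (2 * ee * pp + 2) * (2 * ee * pp + 2))%N.
    by rewrite leq_mul // ltnW.
  move: nB nn => /ltnW; rewrite -!(ler_nat R) => nB nn.
  have npv : n%:R * v^-1 <= ((2 * ee * pp + 2) * pp)%:R.
    by rewrite natrM ler_pM.
  have : 0 <= n%:R * v^-1 by rewrite mulr_ge0.
  rewrite !(natrD _ (_ + _)%N) (natrD _ (_ * _)%N).
  have := ler0n R (2 * ee * pp * pp).
  have := ler0n R ((2 * ee * pp + 2) * pp).
  have := ler0n R ((2 * ee * pp + 2) * (2 * ee * pp + 2)).
  have := ler0n R ((n * n) %/ a.-1.+1).
  by move=> *; lra.
have a0 : (0 < a)%N.
  rewrite lt0n; apply/eqP => E; move: h1 h2; rewrite E.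
  move: Bn; rewrite -(ler_nat R) natrD !natrM => Bn.
  move=> h1 h2.
  have : n%:R * v <= ee%:R by lra.
  have : 0 <= ee%:R :> R by [].
  have : (2 * ee%:R * pp%:R + 2) * v <= n%:R * v by rewrite ler_pM2r.
  have -> : (2 * ee%:R * pp%:R + 2) * v = 2 * (ee%:R * (pp%:R * v)) + 2 * v by ring.
  have : ee%:R * 1 <= ee%:R * (pp%:R * v) by rewrite ler_wpM2l.
  by lra.
have := divn_error R (n * n) a.-1; rewrite prednK //.
set q := (_ %/ _)%N; rewrite !natrD !natrM.
move=> [q1 q2].
move: Bn; rewrite -(ler_nat R) natrD !natrM => Bn.
have a0' : 0 < a%:R :> R by rewrite ltr0n.
have := inv_error Bn h1 h2 a0' v0 pv (ler0n _ _) (ler0n _ _) (ler0n _ _) q1 q2.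
by rewrite ler_norml.
Qed.

Lemma approximable_sum (R : realType) (x : nat -> nat -> R) :
  approximable x -> approximable (fun i _ => \sum_(0 <= v < 2 ^ i) x i v).
Proof.
move=> [f [e [rf re fe]]].
exists (fun n i _ => \sum_(0 <= v < 2 ^ i) f n i v)%N.
exists (fun i _ => \sum_(0 <= v < 2 ^ i) e i v)%N; split.
- apply: (@recursive_sum 3 (fun v n i => f n i v)); by rec.
- apply: (@recursive_sum 2 (fun v i _ => e i v) _ _ (fun=> 0%N)); by rec.
- move=> n i _; rewrite !natr_sum mulr_sumr -sumrB.
  by apply: (le_trans (ler_norm_sum _ _ _)); exact: ler_sum.
Qed.

Fixpoint running_max (R : realType) (x : nat -> R) (n : nat) : R :=
  if n is m.+1 then Num.max (running_max x m) (x m.+1) else x 0%N.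

Lemma max_dist (R : realType) (a b c d e : R) :
  `|a - b| <= e -> `|c - d| <= e -> `|Num.max a c - Num.max b d| <= e.
Proof.
rewrite !ler_norml.
move=> /andP[? ?] /andP[? ?].
by have [?|?] := leP a c; have [?|?] := leP b d; apply/andP; split; lra.
Qed.

Lemma approximable_running_max (R : realType) (x : nat -> nat -> R) :
  approximable x ->
  approximable (fun i j => running_max (fun k => x k j) i).
Proof.
move=> [f [e [rf re fe]]].
exists (fun n i j => \max_(0 <= k < i.+1) f n k j)%N.
(* A maximum moves by at most the largest error; the sum of the errors dominates each of them. *)
exists (fun i j => \sum_(0 <= k < i.+1) e k j)%N; split.
- by apply: (@recursive_runmax 3 (fun k n j => f n k j)); rec.
- by apply: (@recursive_sum 2 (fun k j _ => e k j) _ _ (fun=> 0%N)); rec.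
move=> n i j; elim: i => [|i IH] /=; first by rewrite !big_nat1.
rewrite big_nat_recr //= [in leRHS]big_nat_recr //= natrD.
rewrite natr_max maxr_pMr //.
apply: max_dist; first by apply: (le_trans IH); rewrite lerDl.
by apply: (le_trans (fe _ _ _)); rewrite lerDr.
Qed.

Lemma natr_lt_exp2 (R : realType) n : n%:R < 2 ^+ n :> R.
Proof. by rewrite -natrX ltr_nat ltn_expl. Qed.

(** At precision [2 ^- n] the error after scaling by [n] is below 1, and rounding down costs at most
    1 more. Truncated subtraction turns a negative approximation into 0, which is only closer to a
    nonnegative mass. *)
Lemma approximable_str_measure (R : realType)
    (nu : probability borel_cantor R) :
  computable_measure nu -> approximable (fun l v => str_measure nu (bits l v)).
Proof.
move=> [q [[a [b [c [ra rb rc qE]]]] qx]].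
exists (fun n l v => (n * (a [tuple l; v; n] - b [tuple l; v; n])) %/
   (c [tuple l; v; n]).+1)%N.
exists (fun _ _ => 2%N); split.
- rec.
  + by apply: recursive_comp3 => //; rec.
  + by apply: recursive_comp3 => //; rec.
  + by apply: recursive_comp3 => //; rec.
- by rec.
move=> n l v; have := qx (bits l v) n.
have -> : q (bits l v) n = uncurry3 (fun l v n => q (bits l v) n) [tuple l; v; n].
  by [].
rewrite qE; set A := a _; set B := b _; set C := c _.
have : 0 <= str_measure nu (bits l v) by rewrite fine_ge0.
set x := str_measure _ _ => x0.
have := divn_error R (n * (A - B)) C; set Q := (_ %/ _)%N => -[Q1 Q2].
rewrite fmorph_div /= rmorphB /= !ratr_nat.
have d0 : 0 < C.+1%:R :> R by [].
move=> H.
have H2 : n%:R * `|(A%:R - B%:R) / C.+1%:R - x| <= 1.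
  apply: (@le_trans _ _ (2 ^+ n * 2 ^- n)).
    by apply: ler_pM => //; rewrite ltW // natr_lt_exp2.
  by rewrite mulfV // expf_neq0.
have H3 : n%:R * `|(A - B)%N%:R / C.+1%:R - x| <= 1.
  have [AB|BA] := leqP B A; first by rewrite natrB.
  apply: (le_trans _ H2); apply: ler_wpM2l => //.
  rewrite (_ : (A - B)%N = 0%N); last by apply/eqP; rewrite subn_eq0 ltnW.
  rewrite mul0r sub0r normrN ger0_norm //.
  have : (A%:R - B%:R) / C.+1%:R <= 0 :> R.
    by rewrite pmulr_lle0 ?invr_gt0 // subr_le0 ler_nat ltnW.
  move: (_ / _) => y y0; have yx : y - x <= 0 by lra.
  by rewrite ler0_norm //; lra.
have n0 : 0 <= n%:R :> R by [].
rewrite -(ger0_norm n0) -normrM mulrBr mulrA -natrM in H3.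
move: H3 Q1 Q2; rewrite -(ler_pdivlMr _ _ d0) -(ler_pdivrMr _ _ d0).
move: (_ / _) => y; rewrite !ler_norml => /andP[h1 h2] h3 h4.
by apply/andP; split; lra.
Qed.

(** The constant [C] may be any real, since the algorithm uses only a natural number above its
    absolute value. *)
Lemma computable_real_limit (R : realType) (S : nat -> nat -> R) (K : nat -> nat)
    (r C : R) :
  approximable S -> recursive (uncurry1 K) ->
  (forall n, `|S (K n) 0%N - r| <= C * 2 ^- n) -> computable_real r.
Proof.
move=> [f [e [rf re fe]]] rK Sr.
pose c := (Num.bound `|C|).
(* Scale [P n + 1] makes the approximation error at most [2 ^- n.+1]. The index shift by [c.+1]
   leaves the same amount for the distance to the limit, because [C <= 2 ^ c]. *)
pose P n := (2 ^ n.+1 * e (K (n + c.+1)) 0)%N.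
have rP : recursive (uncurry1 P) by rewrite /P; rec.
exists (fun n => (f (P n).+1 (K (n + c.+1)%N) 0%N)%:R / (P n).+1%:R); split.
  exists (fun t => f (P (nth 0 t 0)).+1 (K (nth 0 t 0 + c.+1)%N) 0)%N.
  exists (fun _ => 0%N), (fun t => P (nth 0 t 0))%N; split.
  - by rec.
  - by rec.
  - by rec.
  - by move=> t; rewrite subr0.
move=> n; rewrite fmorph_div /= !ratr_nat.
have := Sr (n + c.+1)%N; have := fe (P n).+1 (K (n + c.+1)%N) 0%N.
set x := S _ _; set F := f _ _ _; set E := e _ _ in P rP F *.
have PE : (P n)%:R = 2 ^+ n.+1 * E%:R :> R by rewrite /P natrM natrX.
have p0 : 0 < (P n).+1%:R :> R by [].
move=> h1 h2.
have h3 : `|F%:R / (P n).+1%:R - x| <= 2 ^- n.+1.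
  rewrite -(ler_pM2l p0) -{1}(ger0_norm (ltW p0)) -normrM mulrBr mulrCA mulfV ?gt_eqF // mulr1.
  apply: (le_trans h1); rewrite ler_pdivlMr ?exprn_gt0 //.
  by rewrite -[(P n).+1%:R]natr1 PE mulrC lerDl.
have h4 : C * 2 ^- (n + c.+1) <= 2 ^- n.+1.
  rewrite addnS -addSn exprD invfM mulrCA ler_piMr ?invr_ge0 ?exprn_ge0 //.
  rewrite ler_pdivrMr ?exprn_gt0 // mul1r.
  apply: (le_trans (ler_norm _)).
  apply: (@le_trans _ _ c%:R); last by rewrite ltW // natr_lt_exp2.
  by rewrite ltW // archi_boundP.
apply: (le_trans (ler_distD x _ _)).
have -> : 2 ^- n = 2 ^- n.+1 + 2 ^- n.+1 :> R.
  by rewrite exprS invfM mulrC -splitr.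
by apply: lerD => //; exact: le_trans h2 h4.
Qed.

(** * Martingales on the binary tree *)

(* The numbers [v < 2 ^ k] encode the nodes at depth [k] of the binary tree,
   the children of [v] being [v] and [v + 2 ^ k]. *)
Definition tree_additive (R : realType) (p : nat -> nat -> R) : Prop :=
  forall k v, (v < 2 ^ k)%N -> p k v = p k.+1 v + p k.+1 (v + 2 ^ k)%N.

(** Periodicity with period [2 ^ k]: the value depends only on the ancestor at depth [k]. One
    function on codes thus serves at all deeper levels. *)
Definition determined_at (R : realType) (k : nat) (g : nat -> R) : Prop :=
  forall j v, (k <= j)%N -> g (v + 2 ^ j)%N = g v.

(** When the [p k v] are the masses of the nodes at depth [k], this is an integral. *)
Definition level_sum (R : realType) (p : nat -> nat -> R) (k : nat)
    (g : nat -> R) : R := \sum_(0 <= v < 2 ^ k) p k v * g v.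

Lemma big_exp2S (V : Type) (idx : V) (op : Monoid.com_law idx) k
    (g : nat -> V) :
  \big[op/idx]_(0 <= v < 2 ^ k.+1) g v =
  \big[op/idx]_(0 <= v < 2 ^ k) op (g v) (g (v + 2 ^ k)%N).
Proof.
rewrite expnS mul2n -addnn (big_cat_nat _ (leq_addl _ _)) //= big_split /=.
by congr (op _ _); rewrite -{1}[(2 ^ k)%N]add0n big_addn addnK.
Qed.

Section level_sum_theory.
Context {R : realType}.
Implicit Types (p : nat -> nat -> R) (g : nat -> R).

Lemma level_sumS p k g : tree_additive p -> determined_at k g ->
  level_sum p k.+1 g = level_sum p k g.
Proof.
move=> pA gk; rewrite /level_sum big_exp2S; apply: eq_big_nat => v /andP[_ vk].
by rewrite /= gk // -mulrDl -pA.
Qed.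

Lemma level_sum_shift p k i g : tree_additive p -> determined_at k g ->
  level_sum p (k + i) g = level_sum p k g.
Proof.
move=> pA gk; elim: i => [|i IH]; first by rewrite addn0.
rewrite addnS level_sumS // => j v kj; apply: gk.
by rewrite (leq_trans _ kj) // leq_addr.
Qed.

Lemma eq_level_sum p k g g' : (forall v, (v < 2 ^ k)%N -> g v = g' v) ->
  level_sum p k g = level_sum p k g'.
Proof. by move=> gg; apply: eq_big_nat => v /andP[_ /gg ->]. Qed.

Lemma ler_level_sum p k g g' : (forall k v, 0 <= p k v) ->
  (forall v, g v <= g' v) -> level_sum p k g <= level_sum p k g'.
Proof. by move=> p0 gg; apply: ler_sum => v _; apply: ler_wpM2l. Qed.

Lemma level_sumD p k g g' :
  level_sum p k (fun v => g v + g' v) = level_sum p k g + level_sum p k g'.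
Proof.
by rewrite /level_sum -big_split; apply: eq_bigr => v _; rewrite mulrDr.
Qed.

Lemma level_sumZ p k c g :
  level_sum p k (fun v => c * g v) = c * level_sum p k g.
Proof.
by rewrite /level_sum mulr_sumr; apply: eq_bigr => v _; rewrite mulrCA.
Qed.

Lemma level_sumN p k g : level_sum p k (fun v => - g v) = - level_sum p k g.
Proof.
by rewrite /level_sum -sumrN; apply: eq_bigr => v _; rewrite mulrN.
Qed.

End level_sum_theory.

(** * Doob's maximal inequality in mean square on the tree *)

Section maximal_inequality.
Context {R : realType} (p q M : nat -> nat -> R).
Hypotheses (p0 : forall k v, 0 <= p k v) (q0 : forall k v, 0 <= q k v)
  (pA : tree_additive p) (qA : tree_additive q)
  (pM : forall k v, p k v * M k v = q k v)
  (Mdet : forall k, determined_at k (M k)).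

Lemma determined_le k j (g : nat -> R) :
  (k <= j)%N -> determined_at k g -> determined_at j g.
Proof. by move=> kj gk i v ji; apply: gk; exact: leq_trans ji. Qed.

(** The martingale property, tested against functions known at depth [k]. As [p * M = q], both sides
    are [q]-sums of [g]. *)
Lemma level_sum_martingale k i (g : nat -> R) : determined_at k g ->
  level_sum p (k + i) (fun v => M (k + i) v * g v) =
  level_sum p k (fun v => M k v * g v).
Proof.
move=> gk; have E j : level_sum p j (fun v => M j v * g v) = level_sum q j g.
  by apply: eq_bigr => v _; rewrite mulrA pM.
by rewrite !E level_sum_shift.
Qed.

Variable N : nat.

Let y i v := M (N + i) v - M N v.

(** The initial 0 is [y 0 v]: this is the running maximum of the martingale [y], which starts at
    0. *)
Fixpoint max_increment (i : nat) (v : nat) : R :=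
  if i is j.+1 then Num.max (max_increment j v) (y j.+1 v) else 0.

Lemma max_increment_ge0 i v : 0 <= max_increment i v.
Proof. by elim: i => [//|i IH] /=; rewrite le_max IH. Qed.

Lemma max_increment_det i : determined_at (N + i) (max_increment i).
Proof.
elim: i => [|i IH] j v Nj //=.
by rewrite IH ?(leq_trans _ Nj) ?addnS // /y !Mdet // (leq_trans _ Nj) ?leq_addr.
Qed.

Lemma level_sum_martingale_increment i (g : nat -> R) :
  determined_at (N + i) g ->
  level_sum p (N + i.+1) (fun v => y i.+1 v * g v) =
  level_sum p (N + i) (fun v => y i v * g v).
Proof.
move=> gi; rewrite /y.
have E j : level_sum p (N + j) (fun v => (M (N + j) v - M N v) * g v) =
    level_sum p (N + j) (fun v => M (N + j) v * g v) -
    level_sum p (N + j) (fun v => M N v * g v).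
  rewrite -level_sumN -level_sumD; apply: eq_level_sum => v _.
  by rewrite mulrBl.
have := level_sum_martingale 1 gi; rewrite !addn1 !E !addnS => ->.
congr (_ - _); rewrite level_sumS // => j v Nj.
by rewrite gi // Mdet // (leq_trans _ Nj) // leq_addr.
Qed.

(* Where the running maximum [d] increases to [d'], it equals the new value
   [y'], so [d' ^+ 2 - d ^+ 2 <= 2 * d' * (d' - d) = 2 * y' * (d' - d)]. *)
Lemma max_increment_sqr_le i :
  level_sum p (N + i) (fun v => max_increment i v ^+ 2) <=
  2 * level_sum p (N + i) (fun v => y i v * max_increment i v).
Proof.
elim: i => [|i IH].
  rewrite /level_sum big1 => [|v _ /=]; last by rewrite expr2 !mulr0.
  by rewrite big1 ?mulr0 // => v _ /=; rewrite !mulr0.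
set d := max_increment i in IH *.
have dN : determined_at (N + i) d by apply: max_increment_det.
have d2N : determined_at (N + i) (fun v => d v ^+ 2).
  by move=> j v Nj; rewrite dN.
(* The old maximum [d] pairs with [y i.+1] as with [y i], so the induction hypothesis says that the
   terms [d ^+ 2 - 2 * y' * d] have a nonpositive sum. *)
have E1 := level_sum_martingale_increment dN.
have := level_sumS pA d2N; rewrite -addnS => E2.
rewrite -E1 -E2 in IH.
apply: (@le_trans _ _ (level_sum p (N + i.+1)
  (fun v => d v ^+ 2 + 2 * (y i.+1 v * max_increment i.+1 v) +
     (- (2 * (y i.+1 v * d v)))))).
  apply: ler_level_sum => // v /=; rewrite -/d.
  have d0 := max_increment_ge0 i v; rewrite -/d in d0.
  move: (y i.+1 v) (d v) d0 => y' x x0.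
  have [xy|yx] := leP x y'; last by lra.
  by have := sqr_ge0 (y' - x); lra.
by rewrite !level_sumD level_sumN !level_sumZ; lra.
Qed.

(** Bounding [2 * y * d] by [2 * y ^+ 2 + d ^+ 2 / 2] in [max_increment_sqr_le] lets half of the
    left side be absorbed, in place of Cauchy-Schwarz. *)
Lemma doob_L2 i :
  level_sum p (N + i) (fun v => max_increment i v ^+ 2) <=
  4 * level_sum p (N + i) (fun v => y i v ^+ 2).
Proof.
have H := max_increment_sqr_le i.
have : level_sum p (N + i) (fun v => 2 * (y i v * max_increment i v)) <=
    level_sum p (N + i) (fun v => 2 * y i v ^+ 2 +
       2^-1 * max_increment i v ^+ 2).
  apply: ler_level_sum => // v.
  by have := sqr_ge0 (2 * y i v - max_increment i v); lra.
by rewrite level_sumD !level_sumZ; lra.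
Qed.

(** A new maximum after depth [N] is some [M (N + j) v], and the maximum up to [N] is at least
    [M N v], so the gain is at most [y j v]. *)
Lemma running_max_increment i v :
  running_max (M^~ v) (N + i) - running_max (M^~ v) N <= max_increment i v.
Proof.
have MN : M N v <= running_max (M^~ v) N.
  by case: N => [|n] //=; rewrite le_max lexx orbT.
elim: i => [|i IH]; first by rewrite addn0 subrr.
rewrite addnS /= -addnS.
have h1 : max_increment i v <= Num.max (max_increment i v) (y i.+1 v).
  by rewrite le_max lexx.
have h2 : y i.+1 v <= Num.max (max_increment i v) (y i.+1 v).
  by rewrite le_max lexx orbT.
rewrite lerBlDr ge_max; apply/andP; split; first by lra.
by rewrite /y in h1 h2 *; lra.
Qed.

Lemma running_max_det j : determined_at j (fun v => running_max (M^~ v) j).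
Proof.
elim: j => [|j IH] i v ji /=; first exact: Mdet.
by rewrite (IH _ _ (ltnW ji)) (Mdet _ ji).
Qed.

(** Pythagoras: [M (N + i) - F] is the sum of [y i] and [M N - F], and [y i] is orthogonal to every
    function determined at depth [N]. *)
Lemma increment_sqr_le i (F : nat -> R) : determined_at N F ->
  level_sum p (N + i) (fun v => y i v ^+ 2) <=
  level_sum p (N + i) (fun v => (M (N + i) v - F v) ^+ 2).
Proof.
move=> FN; pose g v := M N v - F v.
have gN : determined_at N g by move=> j v Nj; rewrite /g FN // Mdet.
(* Orthogonality descends by the martingale property to depth [N], where [y 0 = 0]. *)
have Z : level_sum p (N + i) (fun v => y i v * g v) = 0.
  elim: i => [|i IH].
    by rewrite /level_sum big1 // => v _; rewrite /y addn0 subrr mul0r mulr0.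
  rewrite level_sum_martingale_increment //.
  by apply: determined_le gN; rewrite leq_addr.
rewrite -[leLHS]addr0 -[0](mulr0 2) -Z -level_sumZ -level_sumD.
apply: ler_level_sum => // v; rewrite /g /y.
by have := sqr_ge0 (M N v - F v); lra.
Qed.

Definition mean_running_max k : R :=
  \sum_(0 <= v < 2 ^ k) q k v * running_max (M^~ v) k.

(** The [q]-mean of the increment [d] of the maximum is the [p]-mean of [M * d], and [M * d <= l / 2
    * M ^+ 2 + d ^+ 2 / (2 * l)]. The weight [l] stays free so that it can later be matched to the
    size of [D]. *)
Lemma mean_running_max_gap i (F : nat -> R) (C D l : R) : 0 < l ->
  determined_at N F ->
  level_sum p (N + i) (fun v => M (N + i) v ^+ 2) <= C ->
  level_sum p (N + i) (fun v => (M (N + i) v - F v) ^+ 2) <= D ->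
  mean_running_max (N + i) <= mean_running_max N + (l * C + 4 * D / l) / 2.
Proof.
move=> l0 FN HC HD.
rewrite -lerBlDl.
have -> : mean_running_max N =
    level_sum q (N + i) (fun v => running_max (M^~ v) N).
  by rewrite level_sum_shift //; exact: running_max_det.
rewrite -[mean_running_max _]/(level_sum q (N + i)
  (fun v => running_max (M^~ v) (N + i))).
rewrite -level_sumN -level_sumD.
apply: (@le_trans _ _ (level_sum q (N + i) (max_increment i))).
  by apply: ler_level_sum => // v; exact: running_max_increment.
have -> : level_sum q (N + i) (max_increment i) =
    level_sum p (N + i) (fun v => M (N + i) v * max_increment i v).
  by apply: eq_bigr => v _; rewrite mulrA pM.
apply: (@le_trans _ _ (level_sum p (N + i) (fun v =>
    l / 2 * M (N + i) v ^+ 2 + (2 * l)^-1 * max_increment i v ^+ 2))).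
  apply: ler_level_sum => // v.
  move: (M _ v) (max_increment i v) => x d.
  rewrite -subr_ge0.
  have -> : l / 2 * x ^+ 2 + (2 * l)^-1 * d ^+ 2 - x * d =
      (2 * l)^-1 * (l * x - d) ^+ 2.
    by field; rewrite gt_eqF.
  by rewrite mulr_ge0 ?sqr_ge0 // invr_ge0 mulr_ge0 // ltW.
have -> : (l * C + 4 * D / l) / 2 = l / 2 * C + (2 * l)^-1 * (4 * D).
  by field; rewrite gt_eqF.
rewrite level_sumD !level_sumZ; apply: lerD.
  by rewrite ler_wpM2l // divr_ge0 // ltW.
rewrite ler_wpM2l ?invr_ge0 ?mulr_ge0 ?(ltW l0) //.
by have := doob_L2 i; have := increment_sqr_le i FN; lra.
Qed.

End maximal_inequality.

(** * Cylinders and measures on Cantor space *)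

Lemma bitsS_lo k v : (v < 2 ^ k)%N -> bits k.+1 v = rcons (bits k v) false.
Proof. by move=> vk; rewrite /bits mkseqS divn_small. Qed.

Lemma bits_add_exp k j v : (j <= k)%N -> bits j (v + 2 ^ k) = bits j v.
Proof.
move=> jk; apply/eq_in_map => i; rewrite mem_iota add0n => /andP[_ ij].
have ik : (i < k)%N by exact: leq_trans jk.
rewrite -(subnK (ltnW ik)) expnD addnC divnMDl ?expn_gt0 //.
by rewrite oddD oddX subn_eq0 leqNgt ik.
Qed.

Lemma bitsS_hi k v : (v < 2 ^ k)%N ->
  bits k.+1 (v + 2 ^ k) = rcons (bits k v) true.
Proof.
move=> vk; rewrite /bits mkseqS -/(bits k _) bits_add_exp //.
by rewrite divnDr ?dvdnn // divn_small // divnn expn_gt0.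
Qed.

Lemma size_bits k v : size (bits k v) = k.
Proof. exact: size_mkseq. Qed.

Lemma cylinder_rcons s b :
  cylinder (rcons s b) = cylinder s `&` [set w | w (size s) = b].
Proof.
apply/seteqP; split => w; rewrite /cylinder /prefix_of /= size_rcons mkseqS.
  by move=> /rcons_inj[].
by move=> [-> ->].
Qed.

Lemma measurable_cylinder s : measurable (cylinder s).
Proof.
elim/last_ind: s => [|s b IH].
  by rewrite (_ : cylinder [::] = setT) //; apply/seteqP; split.
rewrite cylinder_rcons; apply: measurableI => //.
apply: sub_sigma_algebra.
suff : @open cantor_space (@proj nat (fun=> bool) (size s) @^-1` [set b]) by [].
by apply: open_comp; [move=> + _; exact: proj_continuous|exact: discrete_open].
Qed.

Lemma cylinder_children s :
  cylinder s = cylinder (rcons s false) `|` cylinder (rcons s true).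
Proof.
rewrite !cylinder_rcons -setIUr (_ : _ `|` _ = setT) ?setIT //.
by apply/seteqP; split => // w _ /=; case: (w _); [right|left].
Qed.

Lemma disjoint_cylinder_children s :
  cylinder (rcons s false) `&` cylinder (rcons s true) = set0.
Proof.
by rewrite !cylinder_rcons; apply/seteqP; split => // w [[_ /= ->] []].
Qed.

Section cantor_measures.
Context {R : realType}.
Implicit Types nu mu : probability borel_cantor R.

Lemma str_measureE nu s : (str_measure nu s)%:E = nu (cylinder s).
Proof. by rewrite fineK // fin_num_measure //; exact: measurable_cylinder. Qed.

Lemma str_measure_ge0 nu s : 0 <= str_measure nu s.
Proof. exact: fine_ge0. Qed.

Lemma tree_additive_str_measure nu :
  tree_additive (fun k v => str_measure nu (bits k v)).
Proof.
move=> k v vk; apply: EFin_inj; rewrite EFinD !str_measureE.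
rewrite bitsS_lo // bitsS_hi // [in LHS]cylinder_children measureU //.
- exact: measurable_cylinder.
- exact: measurable_cylinder.
- exact: disjoint_cylinder_children.
Qed.

Lemma integral_cylinders nu (k : nat) (f : borel_cantor -> \bar R) :
  measurable_fun setT f -> (forall w, 0 <= f w)%E ->
  (\int[nu]_w f w =
   \sum_(0 <= v < 2 ^ k) \int[nu]_(w in cylinder (bits k v)) f w)%E.
Proof.
move=> mf f0; elim: k => [|k ->].
  rewrite expn0 big_nat1 (_ : cylinder _ = setT) //.
  by apply/seteqP; split.
rewrite big_exp2S; apply: eq_big_nat => v /andP[_ vk].
rewrite bitsS_lo // bitsS_hi // [in LHS]cylinder_children.
rewrite ge0_integral_setU //.
- exact: measurable_cylinder.
- exact: measurable_cylinder.
- exact: measurable_funTS.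
- by rewrite disj_set2E disjoint_cylinder_children.
Qed.

(** The digits of [v] followed by zeros: a point that lies in the cylinder of [bits k v] for all [k]
    at once. *)
Definition cantor_point (v : nat) : borel_cantor := fun i => odd (v %/ 2 ^ i).

Definition prefix_determined (k : nat) (f : borel_cantor -> R) : Prop :=
  forall w w', prefix_of w k = prefix_of w' k -> f w = f w'.

Lemma prefix_determined_cylinder k f v w : prefix_determined k f ->
  cylinder (bits k v) w -> f w = f (cantor_point v).
Proof. by move=> fk; rewrite /cylinder /= size_bits => wv; apply: fk. Qed.

Lemma prefix_determined_point k f : prefix_determined k f ->
  determined_at k (f \o cantor_point).
Proof. by move=> fk j v kj; apply: fk; exact: bits_add_exp. Qed.

Lemma integral_prefix_determined nu (k : nat) (f : borel_cantor -> R) :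
  measurable_fun setT f -> (forall w, 0 <= f w) -> prefix_determined k f ->
  (\int[nu]_w (f w)%:E =
   (level_sum (fun k v => str_measure nu (bits k v)) k
     (f \o cantor_point))%:E)%E.
Proof.
move=> mf f0 fk; rewrite (integral_cylinders _ k) //; last exact/measurable_EFinP.
rewrite /level_sum -sumEFin; apply: eq_bigr => v _.
rewrite (eq_integral (fun=> (f (cantor_point v))%:E)); last first.
  by move=> w; rewrite inE => /(prefix_determined_cylinder fk) ->.
rewrite integral_cst; last exact: measurable_cylinder.
by rewrite -[X in (_ * X)%E]/(nu (cylinder (bits k v))) -str_measureE -EFinM mulrC.
Qed.

(** * Square-integrable densities *)

Section derivative.
Variables (nu mu : probability borel_cantor R) (h : borel_cantor -> R).
Hypotheses (h1 : mu.-integrable setT (EFin \o h))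
  (h2 : mu.-integrable setT (EFin \o (fun w => h w ^+ 2)))
  (nuE : forall A, measurable A -> nu A = (\int[mu]_(w in A) (h w)%:E)%E).

Lemma integrable_affine a b :
  mu.-integrable setT (EFin \o (fun w => a * h w + b)).
Proof.
rewrite (_ : _ \o _ = fun w => a%:E * (EFin \o h) w + (cst b%:E) w)%E //.
apply: integrableD => //; first exact: integrableZl.
exact: finite_measure_integrable_cst.
Qed.

Lemma integral_affine a b A : measurable A ->
  (\int[mu]_(w in A) (a * h w + b)%:E = a%:E * nu A + b%:E * mu A)%E.
Proof.
move=> mA; under eq_integral do rewrite EFinD EFinM.
rewrite integralD //; last 2 first.
- by apply: integrableZl => //; exact: integrableS h1.
- by apply: (integrableS measurableT) => //; exact: finite_measure_integrable_cst.
rewrite integralZl //; last exact: integrableS h1.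
by rewrite nuE // integral_cst.
Qed.

Lemma integrable_affine_sqr c :
  mu.-integrable setT (EFin \o (fun w => (h w - c) ^+ 2)).
Proof.
rewrite (_ : _ \o _ = (EFin \o (fun w => h w ^+ 2)%R) \+
    (EFin \o (fun w => (- (2 * c)) * h w + c ^+ 2)%R))%E.
  by apply: integrableD => //; exact: integrable_affine.
by apply/funext => w /=; rewrite -EFinD; congr EFin; ring.
Qed.

(* Jensen's inequality for the tangent of [x |-> (x - c) ^+ 2] at the mean. *)
Lemma integral_sqr_dist_ge A c : measurable A -> 0 < fine (mu A) ->
  ((fine (mu A) * (fine (nu A) / fine (mu A) - c) ^+ 2)%:E <=
   \int[mu]_(w in A) ((h w - c) ^+ 2)%:E)%E.
Proof.
move=> mA; have muA : mu A \is a fin_num by exact: fin_num_measure.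
have nuA : nu A \is a fin_num by exact: fin_num_measure.
set a := fine (mu A); set m := _ / a => a0.
have Em : fine (nu A) = m * a by rewrite /m divfK // gt_eqF.
apply: (@le_trans _ _ (\int[mu]_(w in A)
  (2 * (m - c) * h w + (c ^+ 2 - m ^+ 2))%:E)%E).
  rewrite integral_affine // -(fineK nuA) -(fineK muA) -!EFinM -EFinD lee_fin.
  rewrite Em -/a le_eqVlt; apply/orP; left; apply/eqP; ring.
apply: le_integral => //.
- by apply: integrableS (integrable_affine _ _).
- by apply: integrableS (integrable_affine_sqr _).
- move=> w _; rewrite lee_fin -subr_ge0.
  by rewrite (_ : _ - _ = (h w - m) ^+ 2) ?sqr_ge0 //; ring.
Qed.

Hypothesis mu_full : full_support mu.

(** Jensen's inequality on each cylinder of depth [k], where [f] is constant and, by full support,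
    the mass is positive. *)
Lemma level_sum_sqr_dist_le k (f : borel_cantor -> R) :
  measurable_fun setT f -> prefix_determined k f ->
  ((level_sum (fun k v => str_measure mu (bits k v)) k (fun v =>
     (str_measure nu (bits k v) / str_measure mu (bits k v)
        - f (cantor_point v)) ^+ 2))%:E
   <= \int[mu]_w ((h w - f w) ^+ 2)%:E)%E.
Proof.
move=> mf fk; rewrite (integral_cylinders _ k); last 2 first.
- apply/measurable_EFinP; apply: measurable_funX; apply: measurable_funB => //.
  by apply/measurable_EFinP; exact: measurable_int h1.
- by move=> w; rewrite lee_fin sqr_ge0.
rewrite /level_sum -sumEFin; apply: lee_sum => v _.
rewrite [leRHS](eq_integral (fun w => ((h w - f (cantor_point v)) ^+ 2)%:E)).
  by apply: integral_sqr_dist_ge; [exact: measurable_cylinder|exact: mu_full].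
by move=> w; rewrite inE => /(prefix_determined_cylinder fk) ->.
Qed.

Lemma absolute_continuity_bound A (C l : R) : measurable A -> 0 < l ->
  (\int[mu]_w (h w ^+ 2)%:E <= C%:E)%E ->
  (nu A <= ((l * C + fine (mu A) / l) / 2)%:E)%E.
Proof.
move=> mA l0 hC; rewrite nuE //.
have l2 : 0 <= l / 2 by rewrite divr_ge0 // ltW.
have i2 : mu.-integrable A (EFin \o (fun w => h w ^+ 2)).
  exact: integrableS h2.
have ic : mu.-integrable A (cst ((2 * l)^-1)%:E).
  by apply: (integrableS measurableT) => //; exact: finite_measure_integrable_cst.
apply: (@le_trans _ _ (\int[mu]_(w in A)
   ((l / 2)%:E * (EFin \o (fun w => h w ^+ 2)%R) w + (cst ((2 * l)^-1)%:E) w))%E).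
  apply: le_integral => //.
  - exact: integrableS h1.
  - by apply: integrableD => //; exact: integrableZl.
  - move=> w _; rewrite /= -EFinM -EFinD lee_fin -subr_ge0.
    have -> : l / 2 * h w ^+ 2 + (2 * l)^-1 - h w =
        (2 * l)^-1 * (l * h w - 1) ^+ 2 by field; rewrite gt_eqF.
    by rewrite mulr_ge0 ?sqr_ge0 // invr_ge0 mulr_ge0 // ltW.
rewrite integralD //; last exact: integrableZl.
rewrite integralZl //.
have -> : (l * C + fine (mu A) / l) / 2 = l / 2 * C + (2 * l)^-1 * fine (mu A).
  by field; rewrite gt_eqF.
rewrite EFinD !EFinM; apply: leeD.
  apply: lee_pmul => //.
    by apply: integral_ge0 => w _; rewrite lee_fin sqr_ge0.
  apply: le_trans hC; apply: ge0_subset_integral => //.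
    exact: measurable_int h2.
  by move=> w _; rewrite lee_fin sqr_ge0.
by rewrite integral_cst // fineK // fin_num_measure.
Qed.

End derivative.

Lemma Lnorm2_le mu (f : borel_cantor -> R) e : 0 <= e ->
  ('N[mu]_2%:E[EFin \o f] <= e%:E)%E ->
  (\int[mu]_w (f w ^+ 2)%:E <= (e ^+ 2)%:E)%E.
Proof.
move=> e0 H.
have -> : (\int[mu]_w (f w ^+ 2)%:E = 'N[mu]_2%:E[EFin \o f] `^ 2)%E.
  rewrite poweR_Lnorm //; apply: eq_integral => w _ /=.
  by rewrite powR_mulrn // real_normK // num_real.
rewrite -powR_mulrn // -poweR_EFin.
by apply: gt0_ler_poweR => //; rewrite in_itv /= ?leey ?lee_fin ?Lnorm_ge0 ?e0.
Qed.

End cantor_measures.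

Lemma prefix_of_bits (w : borel_cantor) k :
  exists2 v, (v < 2 ^ k)%N & prefix_of w k = bits k v.
Proof.
elim: k => [|k [v vk E]]; first by exists 0%N.
rewrite /prefix_of mkseqS -/(prefix_of w k) E expnS.
case: (w k).
- by exists (v + 2 ^ k)%N; rewrite ?bitsS_hi // mul2n -addnn ltn_add2r.
- by exists v; rewrite ?bitsS_lo // (leq_trans vk) // leq_pmull.
Qed.

Lemma measurable_prefix_determined (R : realType) k (f : borel_cantor -> R) :
  prefix_determined k f -> measurable_fun setT f.
Proof.
move=> fk _ Y _; rewrite setTI.
(* Codes from [2 ^ k] on merely repeat cylinders, so the countable union may range over all
   codes. *)
rewrite (_ : _ @^-1` _ = \bigcup_(v in [set v | Y (f (cantor_point v))])
    cylinder (bits k v)).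
  by apply: bigcup_measurable => v _; exact: measurable_cylinder.
apply/seteqP; split => w /=.
  have [v vk E] := prefix_of_bits w k.
  have wv : cylinder (bits k v) w by rewrite /cylinder /= size_bits.
  by exists v => //=; rewrite -(prefix_determined_cylinder fk wv).
by move=> [v /= ?] /(prefix_determined_cylinder fk) ->.
Qed.

(** * Running maxima of the ratios and their means *)

Lemma running_max_ge (R : realType) (x : nat -> R) j : x j <= running_max x j.
Proof. by case: j => [|j] //=; rewrite le_max lexx orbT. Qed.

Lemma running_max_mem (R : realType) (x : nat -> R) j :
  exists i, running_max x j = x i.
Proof.
elim: j => [|j [i IH]] /=; first by exists 0%N.
by have [_|_] := leP (running_max x j) (x j.+1); [exists j.+1|exists i].
Qed.

Lemma running_max_homo (R : realType) (x : nat -> R) :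
  {homo running_max x : i j / (i <= j)%N >-> i <= j}.
Proof.
apply: homo_leq => //; first by move=> a b c; exact: le_trans.
by move=> n /=; rewrite le_max lexx.
Qed.

(** This replaces the supremum by the limit of a nondecreasing sequence, as monotone convergence
    requires. *)
Lemma ereal_sup_running_max (R : realType) (x : nat -> R) :
  ereal_sup (range (fun n => (running_max x n)%:E)) =
  ereal_sup (range (fun n => (x n)%:E)).
Proof.
apply/eqP; rewrite eq_le; apply/andP; split; apply: ge_ereal_sup => _ [n _ <-].
  by have [i ->] := running_max_mem x n; apply: ereal_sup_ubound; exists i.
apply: le_ereal_sup_tmp; exists (running_max x n)%:E; first by exists n.
by rewrite lee_fin running_max_ge.
Qed.

Section measure_ratio_theory.
Context {R : realType} (nu mu : probability borel_cantor R).
Hypothesis mu_full : full_support mu.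

Definition measure_ratio (k v : nat) : R :=
  str_measure nu (bits k v) / str_measure mu (bits k v).

Definition mean_max_ratio : nat -> R :=
  mean_running_max (fun k v => str_measure nu (bits k v)) measure_ratio.

Lemma measure_ratio_ge0 k v : 0 <= measure_ratio k v.
Proof. by rewrite divr_ge0 // str_measure_ge0. Qed.

Lemma measure_ratio_determined k : determined_at k (measure_ratio k).
Proof. by move=> j v kj; rewrite /measure_ratio bits_add_exp. Qed.

Lemma str_measure_ratio k v :
  str_measure mu (bits k v) * measure_ratio k v = str_measure nu (bits k v).
Proof. by rewrite mulrC divfK // gt_eqF. Qed.

Let X (w : borel_cantor) n : R :=
  str_measure nu (prefix_of w n) / str_measure mu (prefix_of w n).

Let X_determined n : prefix_determined n (X^~ n).
Proof. by move=> w w' ww'; rewrite /X ww'. Qed.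

Lemma prefix_of_le (w w' : borel_cantor) j k : (j <= k)%N ->
  prefix_of w k = prefix_of w' k -> prefix_of w j = prefix_of w' j.
Proof.
move=> jk E; apply/eq_in_map => i; rewrite mem_iota add0n => /andP[_ ij].
have ik : (i < k)%N by exact: leq_trans jk.
by rewrite -(nth_mkseq false w ik) -(nth_mkseq false w' ik) -/(prefix_of _ _) E.
Qed.

Let max_determined n : prefix_determined n (fun w => running_max (X w) n).
Proof.
elim: n => [|n IH] w w' E /=; first exact: X_determined.
by rewrite (IH _ _ (prefix_of_le (leqnSn n) E)) (X_determined E).
Qed.

Let integral_max n :
  (\int[nu]_w (running_max (X w) n)%:E = (mean_max_ratio n)%:E)%E.
Proof.
rewrite (@integral_prefix_determined _ nu n) //.
- exact: measurable_prefix_determined (@max_determined n).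
- move=> w; have [i ->] := running_max_mem (X w) n.
  by rewrite divr_ge0 // str_measure_ge0.
Qed.

Let max_measurable n : measurable_fun setT (fun w => (running_max (X w) n)%:E).
Proof.
by apply/measurable_EFinP; exact: measurable_prefix_determined (@max_determined n).
Qed.

Let max_ge0 n w : (0 <= (running_max (X w) n)%:E)%E.
Proof.
have [i ->] := running_max_mem (X w) n.
by rewrite lee_fin divr_ge0 // str_measure_ge0.
Qed.

Lemma mean_max_ratio_homo : {homo mean_max_ratio : i j / (i <= j)%N >-> i <= j}.
Proof.
move=> i j ij; rewrite -lee_fin -!integral_max.
apply: ge0_le_integral => //; [exact: max_measurable..|].
by move=> w _; rewrite lee_fin running_max_homo.
Qed.

(** Monotone convergence for the running maxima. The bound [B] makes the real [sup] a genuine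
    supremum instead of its default value. *)
Lemma integral_sup_ratio B : (forall n, mean_max_ratio n <= B) ->
  (\int[nu]_w ereal_sup (range (fun n =>
     (str_measure nu (prefix_of w n) / str_measure mu (prefix_of w n))%:E))
     = (sup (range mean_max_ratio))%:E)%E.
Proof.
move=> SB.
have Sub : has_ubound (range mean_max_ratio) by exists B => _ [n _ <-].
have S0 : range mean_max_ratio !=set0 by exists (mean_max_ratio 0), 0%N.
have gnd w : {homo (fun n => (running_max (X w) n)%:E) :
    i j / (i <= j)%N >-> (i <= j)%E}.
  by move=> i j ij; rewrite lee_fin running_max_homo.
transitivity (\int[nu]_w limn (fun n => (running_max (X w) n)%:E))%E.
  apply: eq_integral => w _; rewrite -ereal_sup_running_max.
  have H := ereal_nondecreasing_cvgn (gnd w).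
  by rewrite (cvg_lim (@ereal_hausdorff R) H).
rewrite monotone_convergence //.
rewrite (_ : (fun n => _) = EFin \o mean_max_ratio); last first.
  by apply/funext => n; exact: integral_max.
rewrite -ereal_sup_EFin // image_comp.
have /ereal_nondecreasing_cvgn H : nondecreasing_seq (EFin \o mean_max_ratio).
  by move=> i j ij; rewrite lee_fin mean_max_ratio_homo.
by rewrite (cvg_lim (@ereal_hausdorff R) H).
Qed.

End measure_ratio_theory.

(** The closure properties of [approximable] apply in turn; full support supplies the positive
    denominators. *)
Lemma approximable_mean_max_ratio (R : realType)
    (nu mu : probability borel_cantor R) :
  computable_measure nu -> computable_measure mu -> full_support mu ->
  approximable (fun k _ => mean_max_ratio nu mu k).
Proof.
move=> nu_comp mu_comp mu_full.
have rE k v : measure_ratio nu mu k v =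
    str_measure nu (bits k v) * (str_measure mu (bits k v))^-1 by [].
have apr : approximable (measure_ratio nu mu).
  apply: approximable_mul => [i j|i j||].
  - exact: str_measure_ge0.
  - by rewrite invr_ge0 str_measure_ge0.
  - exact: approximable_str_measure.
  - by apply: approximable_inv; [move=> i j; exact: mu_full|
      exact: approximable_str_measure].
apply: (@approximable_sum R (fun k v => str_measure nu (bits k v) *
   running_max (fun j => measure_ratio nu mu j v) k)).
apply: approximable_mul => [i j|i j||].
- exact: str_measure_ge0.
- by have [k ->] := running_max_mem (fun k => measure_ratio nu mu k j) i; exact: measure_ratio_ge0.
- exact: approximable_str_measure.
- exact: approximable_running_max.
Qed.

Definition simple_sum (R : realType) (m : nat) (q : nat -> rat)
    (s : nat -> seq bool) (w : borel_cantor) : R :=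
  \sum_(i < m) ratr (q i) * \1_(cylinder (s i)) w.

Lemma simple_sum_determined (R : realType) m q s k :
  (forall i, (i < m)%N -> (size (s i) <= k)%N) ->
  prefix_determined k (@simple_sum R m q s).
Proof.
move=> sk w w' ww'; apply: eq_bigr => i _.
rewrite !indicE; congr (_ * (nat_of_bool _)%:R).
apply/idP/idP; rewrite !inE /cylinder /=.
  by rewrite (prefix_of_le (sk i (ltn_ord i)) ww').
by rewrite (prefix_of_le (sk i (ltn_ord i)) ww').
Qed.

(** * Consequences of a square-integrable Radon-Nikodym derivative *)

Section L2_derivative.
Variables (R : realType) (nu mu : probability borel_cantor R).
Hypotheses (nu_mu : nu `<< mu) (mu_full : full_support mu).
Hypothesis h_L2 : RN_derivative nu mu \in Lfun mu 2%:E.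

Let h := RN_derivative nu mu.

Lemma RN_derivativeE w :
  (h w)%:E = Radon_Nikodym (charge_of_finite_measure nu) mu w.
Proof. by rewrite fineK // Radon_Nikodym_fin_num. Qed.

Lemma integrable_RN_derivative : mu.-integrable setT (EFin \o h).
Proof.
rewrite (_ : _ \o _ = Radon_Nikodym (charge_of_finite_measure nu) mu).
  exact: Radon_Nikodym_integrable.
by apply/funext => w /=; exact: RN_derivativeE.
Qed.

Lemma integral_RN_derivative A : measurable A ->
  nu A = (\int[mu]_(w in A) (h w)%:E)%E.
Proof.
move=> mA; under eq_integral do rewrite RN_derivativeE.
by rewrite -Radon_Nikodym_integral.
Qed.

Let h1 := integrable_RN_derivative.
Let nuE := integral_RN_derivative.
Let h2 : mu.-integrable setT (EFin \o (fun w => h w ^+ 2)).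
Proof. exact: Lfun2_integrable_sqr. Qed.

(** The squared norm of [h]. The algorithms see it only through natural numbers that bound it. *)
Definition RN_sqr_mean : R := fine (\int[mu]_w (h w ^+ 2)%:E)%E.

Lemma RN_sqr_meanE : (RN_sqr_mean%:E = \int[mu]_w (h w ^+ 2)%:E)%E.
Proof. by rewrite fineK //; exact: integrable_fin_num h2. Qed.

Lemma RN_sqr_mean_ge0 : 0 <= RN_sqr_mean.
Proof.
by rewrite fine_ge0 // integral_ge0 // => w _; rewrite lee_fin sqr_ge0.
Qed.

Lemma mean_max_ratio_gap N i (f : borel_cantor -> R) D l : 0 < l ->
  prefix_determined N f ->
  (\int[mu]_w ((h w - f w) ^+ 2)%:E <= D%:E)%E ->
  mean_max_ratio nu mu (N + i) <=
    mean_max_ratio nu mu N + (l * RN_sqr_mean + 4 * D / l) / 2.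
Proof.
move=> l0 fN hf.
have fNi : prefix_determined (N + i) f.
  by move=> w w' ww'; apply/fN/(prefix_of_le _ ww'); rewrite leq_addr.
apply: (@mean_running_max_gap R (fun k v => str_measure mu (bits k v))
  (fun k v => str_measure nu (bits k v)) (measure_ratio nu mu) _ _ _ _ _ _ N i
  (f \o cantor_point)) => //.
- by move=> k v; exact: str_measure_ge0.
- by move=> k v; exact: str_measure_ge0.
- exact: tree_additive_str_measure.
- exact: tree_additive_str_measure.
- by move=> k v; exact: str_measure_ratio.
- by move=> k; exact: measure_ratio_determined.
- exact: prefix_determined_point.
(* Comparison with the zero function bounds the second moment of the ratio by that of [h]. *)
- have := @level_sum_sqr_dist_le R nu mu h h1 h2 nuE mu_full (N + i)
    (cst 0) (measurable_cst _) (fun _ _ _ => erefl).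
  rewrite -lee_fin RN_sqr_meanE.
  under [in X in (_ <= X)%E -> _]eq_integral do rewrite subr0.
  apply: le_trans; rewrite lee_fin le_eqVlt; apply/orP; left; apply/eqP.
  by apply: eq_level_sum => v _; rewrite subr0.
- rewrite -lee_fin; apply: le_trans hf.
  by apply: level_sum_sqr_dist_le => //; exact: measurable_prefix_determined fN.
Qed.

Lemma comp_dominated_L2 : comp_dominated nu mu.
Proof.
have C0 := RN_sqr_mean_ge0.
pose c := (Num.bound RN_sqr_mean).
have Cc : RN_sqr_mean <= c.+1%:R.
  by rewrite ltW // (lt_le_trans (archi_boundP C0)) // ler_nat.
exists (fun e => e ^+ 2 / c.+1%:R); split; first split.
- by move=> e e0; rewrite divr_gt0 // exprn_gt0.
(* At [e = i.+1 / j.+1] the numerator is [i.+1 ^ 2] and the denominator [c.+1 * j.+1 ^ 2]; the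
   predecessor compensates the successor in [computable_rat]. *)
- exists (fun t => (nth 0%N t 0).+1 * (nth 0%N t 0).+1)%N, (fun=> 0%N).
  exists (fun t => (c.+1 * ((nth 0%N t 1).+1 * (nth 0%N t 1).+1)).-1)%N.
  split; [by rec|by rec|by rec|] => t.
  rewrite /uncurry2 prednK ?muln_gt0 // subr0 !natrM expr2.
  by rewrite mulf_div -[LHS]mulrA -invfM [c.+1%:R * _]mulrC.
- move=> e e0 A mA; rewrite fmorph_div rmorphXn /= ratr_nat => muA.
  have re0 : 0 < ratr e :> R by rewrite ltr0q.
  move: (ratr e) re0 muA => {e0}e e0 muA.
  have c0 : 0 < c.+1%:R :> R by [].
  (* With [l = e / c.+1] the term [l * c.+1] equals [e] and [mu A / l] is below [e], so their
     average is below [e]. *)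
  have l0 : 0 < e / c.+1%:R by rewrite divr_gt0.
  have le_C : (\int[mu]_w (h w ^+ 2)%:E <= (c.+1%:R : R)%:E)%E.
    by rewrite -RN_sqr_meanE lee_fin.
  have := absolute_continuity_bound h1 h2 nuE mA l0 le_C.
  move=> /le_lt_trans; apply; rewrite lte_fin.
  have : fine (mu A) < e ^+ 2 / c.+1%:R.
    by rewrite -lte_fin fineK // fin_num_measure.
  move: (fine _) => a ae.
  have : a / (e / c.+1%:R) < e.
    rewrite ltr_pdivrMr // (_ : e * (e / _) = e ^+ 2 / c.+1%:R) //; ring.
  by rewrite divfK ?gt_eqF //; lra.
Qed.

End L2_derivative.

Theorem proposition6p5 (R : realType) (nu mu : probability borel_cantor R)
    (nu_comp : computable_measure nu) (mu_comp : computable_measure mu)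
    (nu_full : full_support nu) (mu_full : full_support mu)
    (nu_mu : nu `<< mu)
    (h_comp : L2_computable mu (RN_derivative nu mu)) :
  bdc_dominated nu mu /\ comp_dominated nu mu.
Proof.
have [h_L2 [len [q [s [rlen _ [l [v [rl _ sE]]] fP]]]]] := h_comp.
split; last exact: comp_dominated_L2.
pose f n := @simple_sum R (len n) (q n) (s n).
(* The total length of the strings in the [n]-th approximation: a recursive depth that is at least
   each single length. *)
pose K n := (\sum_(0 <= i < len n) l [tuple n; i])%N.
have rK : recursive (uncurry1 K).
  apply: (@recursive_sum 1 (fun i n _ => l [tuple n; i]) _ _ (fun=> 0%N)); rec.
  by apply: recursive_comp2 => //; rec.
have fK n : prefix_determined (K n) (f n).
  apply: simple_sum_determined => i il.
  have := sE [tuple n; i]; rewrite /uncurry2 /= => ->.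
  rewrite size_bits /K (big_cat_nat (n := i)) ?(ltnW il) //=.
  rewrite (big_ltn il) /= addnCA leq_addr //.
have fh n : (\int[mu]_w ((RN_derivative nu mu w - f n w) ^+ 2)%:E <=
    ((2 ^- n) ^+ 2)%:E)%E.
  have e0 : 0 <= 2 ^- n :> R by rewrite invr_ge0 exprn_ge0.
  have := Lnorm2_le e0 (fP n).
  by under eq_integral do rewrite -sqrrN opprB.
(* This is the constant left by [l = 2 ^- n] and [D = (2 ^- n) ^+ 2], for which both terms of the
   gap are of order [2 ^- n]. *)
pose B := (RN_sqr_mean nu mu + 4) / 2.
have gap n i : mean_max_ratio nu mu (K n + i) <=
    mean_max_ratio nu mu (K n) + B * 2 ^- n.
  have e0 : 0 < 2 ^- n :> R by rewrite invr_gt0 exprn_gt0.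
  apply: (le_trans (mean_max_ratio_gap nu_mu mu_full h_L2 i e0 (fK n) (fh n))).
  rewrite lerD2l le_eqVlt; apply/orP; left; apply/eqP.
  by rewrite /B; field; rewrite gt_eqF.
have B0 : 0 <= B by rewrite /B; have := RN_sqr_mean_ge0 nu mu; lra.
(* Beyond depth [K n] the gap applies; before it, the means are monotone. Hence the supremum is
   within [B * 2 ^- n] of the mean at [K n]. *)
have bound n j : mean_max_ratio nu mu j <=
    mean_max_ratio nu mu (K n) + B * 2 ^- n.
  have [Kj|jK] := leqP (K n) j; first by rewrite -(subnKC Kj).
  apply: (le_trans (mean_max_ratio_homo nu mu (ltnW jK))).
  by rewrite lerDl mulr_ge0 // invr_ge0 exprn_ge0.
have Sub := integral_sup_ratio (bound 0%N).
exists (sup (range (mean_max_ratio nu mu))); split=> //.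
apply: (computable_real_limit (C := B)
  (approximable_mean_max_ratio nu_comp mu_comp mu_full) rK) => n.
have h1 : mean_max_ratio nu mu (K n) <= sup (range (mean_max_ratio nu mu)).
  apply: ub_le_sup; last by exists (K n).
  by exists (mean_max_ratio nu mu (K 0%N) + B * 2 ^- 0) => _ [j _ <-].
have h2 : sup (range (mean_max_ratio nu mu)) <=
    mean_max_ratio nu mu (K n) + B * 2 ^- n.
  apply: ge_sup; first by exists (mean_max_ratio nu mu 0), 0%N.
  by move=> _ [j _ <-].
by rewrite distrC ger0_norm ?subr_ge0 // lerBlDl.
Qed.
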